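(* Let $R$ be a commutative ring and $M$ a nonzero $R$-module. The following statements are equivalent: (1) $M$ is F-regular; (2) every submodule of $M$ is a weakly-endoregular module; (3) every submodule of $M$ is a weakly-morphic and reduced module; (4) every cyclic submodule of $M$ is a weakly-morphic and reduced module; (4') every cyclic submodule of $M$ is a morphic and reduced module; (5) every cyclic submodule of $M$ is a co-reduced module; (6) every cyclic submodule of $M$ is an Abelian endoregular module; (7) every cyclic submodule of $M$ is an F-regular module. (Items (4) and (4') are the two readings of ''(weakly-)morphic and reduced''.)
   Context: Rings are associative and unital; modules are unitary. For an $R$-module $N$ and $a\in R$ put $l_N(a)=\{n\in N: na=0\}$. Definitions for an $R$-module $N$ over a commutative ring $R$: - $N$ is F-regular if for every submodule $K$ of $N$ the sequence $0\to K\otimes_R E\to N\otimes_R E$ is exact for each $R$-module $E$ (i.e. every submodule is pure). - $N$ is weakly-endoregular if $Na$ and $l_N(a)$ are direct summands of $N$ for each $a\in R$. - $N$ is morphic if $N/\varphi(N)\cong\ker(\varphi)$ as $R$-modules for every $\varphi\in\mathrm{End}_R(N)$. - $N$ is weakly-morphic if $N/Na\cong l_N(a)$ as $R$-modules for each $a\in R$. - $N$ is reduced if whenever $a\in R$, $n\in N$ satisfy $na^2=0$, then $nRa=0$. - $N$ is co-reduced if $Na=Na^k$ for every $a\in R$ and every positive integer $k$. - $N$ is Abelian endoregular if $T=\mathrm{End}_R(N)$ is a strongly regular ring, i.e. for each $t\in T$ there is $y\in T$ with $t=t^2y$. *)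

(* Defs.v *)
From HB Require Import structures.
From mathcomp Require Import all_boot all_algebra.
From mathcomp Require Import boolp.
From mathcomp.multinomials Require Import freeg.

Set Implicit Arguments.
Unset Strict Implicit.
Unset Printing Implicit Defensive.

Import GRing.Theory.
Local Open Scope ring_scope.
Local Open Scope quotient_scope.

(* MathComp, with the classical axioms of mathcomp.classical.boolp.           *)
(* R is commutative, so right R-modules are given as left ones: the element   *)
(* written n a on the right is a *: n here.                                   *)
(* The submodules of M are the S : submodClosed M. Membership is boolean,     *)
(* which is no restriction: `[< P >] is the boolean of an arbitrary P : Prop. *)

Record submod (R : pzRingType) (M : lmodType R) (S : submodClosed M) :=
  Submod { submod_val : M; _ : submod_val \in S }.

Section SubmodInstances.
Context (R : pzRingType) (M : lmodType R) (S : submodClosed M).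
HB.instance Definition _ := [isSub for @submod_val R M S].
HB.instance Definition _ := [Choice of submod S by <:].
HB.instance Definition _ := [SubChoice_isSubLmodule of submod S by <:].
End SubmodInstances.

Definition submod_incl (R : pzRingType) (M : lmodType R)
  (S : submodClosed M) : {linear submod S -> M} := val.

Definition isomorphic (R : pzRingType) (A B : lmodType R) : Prop :=
  exists f : {linear A -> B}, bijective f.

Section QuotMod.
Context (R : pzRingType) (M : lmodType R) (S : submodClosed M).

Definition submod_zmod_pred : {pred M} := fun x => x \in S.

Lemma submod_zmod_closed : zmod_closed submod_zmod_pred.
Proof. exact: submodClosedP. Qed.
HB.instance Definition _ :=
  GRing.isZmodClosed.Build M submod_zmod_pred submod_zmod_closed.

Definition submod_zmod : zmodClosed M := submod_zmod_pred.

Definition quotmod : Type := Quotient.quot submod_zmod.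
HB.instance Definition _ := GRing.Zmodule.on quotmod.

Definition quot_pi : M -> quotmod := \pi_(Quotient.quot submod_zmod).

Lemma quot_piP x y : reflect (quot_pi x = quot_pi y) (x - y \in S).
Proof.
rewrite (_ : (x - y \in S) = (x - y \in submod_zmod)) //.
by rewrite Quotient.idealrBE; exact: eqP.
Qed.

Lemma quot_piK : cancel (repr : quotmod -> M) quot_pi.
Proof. exact: reprK. Qed.

Lemma quot_piB : zmod_morphism quot_pi.
Proof. exact: (raddfB \pi_(Quotient.quot submod_zmod)). Qed.

HB.instance Definition _ :=
  GRing.isZmodMorphism.Build M quotmod quot_pi quot_piB.

Definition quot_scale (a : R) (u : quotmod) : quotmod := quot_pi (a *: repr u).

Lemma quot_piZ a x : quot_pi (a *: x) = quot_scale a (quot_pi x).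
Proof.
apply/quot_piP; rewrite -scalerBr rpredZ //; apply/quot_piP.
by rewrite quot_piK.
Qed.

Lemma quot_scaleA a b u : quot_scale a (quot_scale b u) = quot_scale (a * b) u.
Proof. by rewrite -[u]quot_piK -!quot_piZ scalerA. Qed.
Lemma quot_scale1 : left_id 1 quot_scale.
Proof. by move=> u; rewrite -[u]quot_piK -quot_piZ scale1r. Qed.
Lemma quot_scaleDr : right_distributive quot_scale +%R.
Proof.
move=> a u v; rewrite -[u]quot_piK -[v]quot_piK -raddfD -!quot_piZ.
by rewrite scalerDr raddfD.
Qed.
Lemma quot_scaleDl u : {morph quot_scale^~ u : a b / a + b}.
Proof. by move=> a b; rewrite -[u]quot_piK -!quot_piZ scalerDl raddfD. Qed.

HB.instance Definition _ := GRing.Zmodule_isLmodule.Build R quotmod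
  quot_scaleA quot_scale1 quot_scaleDr quot_scaleDl.

Lemma quot_pi_scalable : scalable quot_pi.
Proof. exact: quot_piZ. Qed.
HB.instance Definition _ :=
  GRing.isScalable.Build R M quotmod *:%R quot_pi quot_pi_scalable.

Section Lift.
Context (V : lmodType R) (f : {linear M -> V}).
Hypothesis f0 : {in S, forall x, f x = 0}.

Definition quot_lift of {in S, forall x, f x = 0} :=
  fun u : quotmod => f (repr u).

Lemma quot_liftE x : quot_lift f0 (quot_pi x) = f x.
Proof.
apply/eqP; rewrite -subr_eq0 -linearB f0 //; apply/quot_piP.
by rewrite quot_piK.
Qed.

Lemma quot_lift_linear : linear (quot_lift f0).
Proof.
move=> a u v; rewrite -[u]quot_piK -[v]quot_piK -linearP.
by rewrite !quot_liftE linearP.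
Qed.
HB.instance Definition _ :=
  GRing.isLinear.Build R quotmod V *:%R (quot_lift f0) quot_lift_linear.
End Lift.
End QuotMod.

Section Span.
Context (R : pzRingType) (M : lmodType R) (G : M -> Prop).

Definition span_pred : {pred M} := fun x =>
  `[< forall S : submodClosed M, (forall g, G g -> g \in S) -> x \in S >].

Lemma span_pred_closed : subsemimod_closed span_pred.
Proof.
split; first split.
- by apply/asboolP => S _; exact: rpred0.
- move=> x y /asboolP Gx /asboolP Gy; apply/asboolP => S GS.
  by rewrite rpredD ?Gx ?Gy.
- move=> a x /asboolP Gx; apply/asboolP => S GS.
  by rewrite rpredZ ?Gx.
Qed.
HB.instance Definition _ :=
  GRing.isSubSemiModClosed.Build R M span_pred span_pred_closed.

Definition span : submodClosed M := span_pred.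
End Span.

Section KerImage.
Context (R : pzRingType) (M N : lmodType R) (f : {linear M -> N}).

Definition ker_pred : {pred M} := fun x => f x == 0.
Definition im_pred : {pred N} := fun y => `[< exists x, y = f x >].

Lemma ker_pred_closed : subsemimod_closed ker_pred.
Proof.
split; first split.
- by apply/eqP; rewrite linear0.
- by move=> x y /eqP fx /eqP fy; apply/eqP; rewrite linearD fx fy addr0.
- by move=> a x /eqP fx; apply/eqP; rewrite linearZ /= fx scaler0.
Qed.
HB.instance Definition _ :=
  GRing.isSubSemiModClosed.Build R M ker_pred ker_pred_closed.

Lemma im_pred_closed : subsemimod_closed im_pred.
Proof.
split; first split.
- by apply/asboolP; exists 0; rewrite linear0.
- move=> _ _ /asboolP[x ->] /asboolP[y ->]; apply/asboolP.
  by exists (x + y); rewrite linearD.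
- move=> a _ /asboolP[x ->]; apply/asboolP.
  by exists (a *: x); rewrite linearZ.
Qed.
HB.instance Definition _ :=
  GRing.isSubSemiModClosed.Build R N im_pred im_pred_closed.

Definition ker : submodClosed M := ker_pred.
Definition im : submodClosed N := im_pred.
End KerImage.

Section Tensor.
Context (R : comNzRingType) (N E : lmodType R).

Inductive tensor_rel : {freeg (N * E) / R} -> Prop :=
| tensor_relDl n n' e :
    tensor_rel (<< (n + n', e) >> - << (n, e) >> - << (n', e) >>)
| tensor_relDr n e e' :
    tensor_rel (<< (n, e + e') >> - << (n, e) >> - << (n, e') >>)
| tensor_relZl a n e : tensor_rel (<< (a *: n, e) >> - a *: << (n, e) >>)
| tensor_relZr a n e : tensor_rel (<< (n, a *: e) >> - a *: << (n, e) >>).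

Definition tensor : lmodType R := quotmod (span tensor_rel).

Definition tens (n : N) (e : E) : tensor := quot_pi (span tensor_rel) << (n, e) >>.

End Tensor.

Section FreeLift.
Context (R : comNzRingType) (K : choiceType) (V : lmodType R) (f : K -> V).

Definition free_lift : {freeg K / R} -> V := fglift f.

Lemma free_liftU k : free_lift << k >> = f k.
Proof. by rewrite /free_lift liftU scale1r. Qed.

Lemma free_lift_zmod : zmod_morphism free_lift.
Proof. exact: lift_is_additive. Qed.
HB.instance Definition _ :=
  GRing.isZmodMorphism.Build {freeg K / R} V free_lift free_lift_zmod.

Lemma free_lift_scalable : scalable free_lift.
Proof.
move=> a D; rewrite [a *: D]/(fgscale a D) /fgscale.
rewrite -[in RHS](freeg_sumE D) !raddf_sum.
apply: eq_bigr => x _.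
by rewrite /= /free_lift !liftU scalerA.
Qed.
HB.instance Definition _ :=
  GRing.isScalable.Build R {freeg K / R} V *:%R free_lift free_lift_scalable.
End FreeLift.

Section TensorTheory.
Context (R : comNzRingType) (N E : lmodType R).
Local Notation "n *t e" := (@tens R N E n e) (at level 40).

Lemma tens_rel0 D : tensor_rel D -> quot_pi (span (@tensor_rel R N E)) D = 0.
Proof.
move=> rD; rewrite -(linear0 (quot_pi (span (@tensor_rel R N E)))).
by apply/quot_piP; rewrite subr0; apply/asboolP => S; exact.
Qed.

Lemma tensDl n n' e : (n + n') *t e = n *t e + n' *t e.
Proof.
have /eqP := tens_rel0 (tensor_relDl n n' e).
by rewrite !linearB /= -addrA -opprD subr_eq0 => /eqP.
Qed.

Lemma tensDr n e e' : n *t (e + e') = n *t e + n *t e'.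
Proof.
have /eqP := tens_rel0 (tensor_relDr n e e').
by rewrite !linearB /= -addrA -opprD subr_eq0 => /eqP.
Qed.

Lemma tensZl a n e : (a *: n) *t e = a *: (n *t e).
Proof.
have /eqP := tens_rel0 (tensor_relZl a n e).
by rewrite linearB linearZ subr_eq0 => /eqP.
Qed.

Lemma tensZr a n e : n *t (a *: e) = a *: (n *t e).
Proof.
have /eqP := tens_rel0 (tensor_relZr a n e).
by rewrite linearB linearZ subr_eq0 => /eqP.
Qed.

Lemma tensor_ind (P : tensor N E -> Prop) :
  P 0 -> (forall n e u, P u -> P (n *t e + u)) -> forall u, P u.
Proof.
move=> P0 PS u; rewrite -[u]quot_piK; move: (repr u).
elim/freeg_ind_dom0 => [|k [n e] D _ _ IH]; first by rewrite linear0.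
have -> : << k *g (n, e) >> = k *: << (n, e) >> :> {freeg (N * E) / R}.
  by apply/eqP/freeg_eqP => x; rewrite coeffZ !coeffU mul1r.
rewrite linearD; have := PS (k *: n) e _ IH.
by congr (P (_ + _)); rewrite tensZl; apply/esym; exact: linearZ.
Qed.

Section Lift.
Context (V : lmodType R) (f : N -> E -> V).
Hypotheses (fDl : forall n n' e, f (n + n') e = f n e + f n' e)
  (fDr : forall n e e', f n (e + e') = f n e + f n e')
  (fZl : forall a n e, f (a *: n) e = a *: f n e)
  (fZr : forall a n e, f n (a *: e) = a *: f n e).

Let g : {linear {freeg (N * E) / R} -> V} := free_lift (fun x => f x.1 x.2).

Lemma tensor_lift_subproof : {in span (@tensor_rel R N E), forall D, g D = 0}.
Proof.
move=> D /asboolP /(_ (ker g)) sD; apply/eqP; apply: sD => {}D.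
case=> *; rewrite unfold_in /= /ker_pred ?linearB ?linearZ /= !free_liftU /=.
- by rewrite fDl addrAC addrK subrr.
- by rewrite fDr addrAC addrK subrr.
- by rewrite fZl scalerN subrr.
- by rewrite fZr scalerN subrr.
Qed.

Definition tensor_lift : {linear tensor N E -> V} :=
  quot_lift tensor_lift_subproof.

Lemma tensor_liftE n e : tensor_lift (n *t e) = f n e.
Proof.
exact: etrans (quot_liftE tensor_lift_subproof _) (free_liftU _ _).
Qed.

Lemma tensor_lift_unique (h : {linear tensor N E -> V}) :
  (forall n e, h (n *t e) = f n e) -> h =1 tensor_lift.
Proof.
move=> hE; elim/tensor_ind => [|n e u IH]; first by rewrite !linear0.
by rewrite !linearD hE tensor_liftE IH.
Qed.
End Lift.
End TensorTheory.

Section TensorMap.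
Context (R : comNzRingType) (N N' : lmodType R) (g : {linear N -> N'}).
Context (E : lmodType R).

Let tens_map (n : N) (e : E) : tensor N' E := tens (g n) e.

Lemma tens_mapDl n n' e : tens_map (n + n') e = tens_map n e + tens_map n' e.
Proof. by rewrite /tens_map linearD tensDl. Qed.
Lemma tens_mapDr n e e' : tens_map n (e + e') = tens_map n e + tens_map n e'.
Proof. exact: tensDr. Qed.
Lemma tens_mapZl a n e : tens_map (a *: n) e = a *: tens_map n e.
Proof. by rewrite /tens_map linearZ tensZl. Qed.
Lemma tens_mapZr a n e : tens_map n (a *: e) = a *: tens_map n e.
Proof. exact: tensZr. Qed.

(* g (x) id_E *)
Definition tensor_map : {linear tensor N E -> tensor N' E} :=
  tensor_lift tens_mapDl tens_mapDr tens_mapZl tens_mapZr.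

Lemma tensor_mapE n e : tensor_map (tens n e) = tens (g n) e.
Proof. exact: tensor_liftE. Qed.
End TensorMap.

Section ModuleProperties.
Context (R : comNzRingType) (N : lmodType R).

Definition homothety (a : R) : {linear N -> N} := a \*: idfun.

Definition mul_submod (a : R) : submodClosed N := im (homothety a).

Definition ann_submod (a : R) : submodClosed N := ker (homothety a).

Definition direct_summand (S : submodClosed N) : Prop :=
  exists T : submodClosed N,
    (forall x : N, exists s t : N, [/\ s \in S, t \in T & x = s + t]) /\
    (forall x : N, x \in S -> x \in T -> x = 0).

Definition cyclic_submod (S : submodClosed N) : Prop :=
  exists n : N, forall x : N, x \in S <-> exists r : R, x = r *: n.

Definition pure_submod (K : submodClosed N) : Prop :=
  forall E : lmodType R, injective (tensor_map (submod_incl K) E).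

Definition F_regular : Prop := forall K : submodClosed N, pure_submod K.

Definition weakly_endoregular : Prop :=
  forall a : R, direct_summand (mul_submod a) /\ direct_summand (ann_submod a).

Definition morphic : Prop := forall phi : {linear N -> N},
  isomorphic (quotmod (im phi)) (submod (ker phi)).

Definition weakly_morphic : Prop := forall a : R,
  isomorphic (quotmod (mul_submod a)) (submod (ann_submod a)).

Definition reduced_module : Prop := forall (a : R) (n : N),
  a ^+ 2 *: n = 0 -> forall r : R, a *: (r *: n) = 0.

Definition coreduced : Prop := forall (a : R) (k : nat), (0 < k)%N ->
  mul_submod a =i mul_submod (a ^+ k).

(* The product of End_R(N) is composition, so t ^ 2 y is t \o t \o y. *)
Definition abelian_endoregular : Prop := forall t : {linear N -> N},
  exists y : {linear N -> N}, t =1 t \o t \o y.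

End ModuleProperties.

(* Main.v *)
Require Import Defs.
From HB Require Import structures.
From mathcomp Require Import all_boot all_algebra.
From mathcomp Require Import boolp ring.
From mathcomp.multinomials Require Import freeg.

Set Implicit Arguments.
Unset Strict Implicit.
Unset Printing Implicit Defensive.

Import GRing.Theory.
Local Open Scope ring_scope.

(** Every item is equivalent to one elementary condition, pointwise_regular:
    for all a in R and m in M there is b in R with a m = a^2 b m. It says that
    the quotient of R by the annihilator of m is von Neumann regular for each
    m. It passes to submodules, and it holds in M as soon as each cyclic
    submodule S satisfies a S = a^2 S for all a (regular_of_cyclic), because an
    element of the submodule R m is of the form b m.

    Each item gives a S = a^2 S on the cyclic submodules it speaks of, or
    pointwise regularity directly. If S = a S + T is a direct sum and
    n = a s + t, then a t lies in a S and in T, so a n = a^2 s. If S is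
    weakly morphic and reduced, then S / a^2 S is isomorphic to the annihilator
    of a^2, which a kills, so a S lies in a^2 S. If R a m is a pure submodule,
    tensoring with R / a R gives a m in a R a m (F_regular_regular).

    Conversely, let N be pointwise regular. Then N = a N + l_N(a) is a direct
    sum; this gives weak endoregularity, and N / a N isomorphic to l_N(a). On a
    cyclic module every endomorphism is a homothety, which turns these
    statements about scalars into the ones about all endomorphisms.

    The substantial implication is that pointwise regularity makes every
    submodule K of M pure (regular_F_regular). In general K is neither a direct
    summand of M, nor of the finitely generated submodules containing it.
    However, an element of the tensor product of M and E vanishes because of
    finitely many relations only, so it suffices to retract M onto K by a map of
    sets which respects finitely many prescribed linear relations
    (pure_of_local_retractions). Such maps are built by adding one generator m
    to K at a time (local_retraction_adjoin): the relations produce finitely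
    many scalars t with t m in K, and regularity at m provides a scalar s, an
    idempotent modulo the annihilator of m generating the same ideal as the t's,
    such that s m is in K and t s m = t m. Sending m to s m then works. *)

(** * Submodules *)

Lemma mem_im (R : pzRingType) (M N : lmodType R) (f : {linear M -> N}) y :
  reflect (exists x, y = f x) (y \in im f).
Proof. exact: asboolP. Qed.

Lemma mem_ker (R : pzRingType) (M N : lmodType R) (f : {linear M -> N}) x :
  reflect (f x = 0) (x \in ker f).
Proof. exact: eqP. Qed.

Lemma submod_val_inj (R : pzRingType) (M : lmodType R) (S : submodClosed M) :
  injective (submod_incl S).
Proof. exact: val_inj. Qed.

Lemma submodB (R : pzRingType) (M : lmodType R) (S : submodClosed M) :
  {in S &, forall x y, x - y \in S}.
Proof. by move=> x y Sx Sy; rewrite -scaleN1r rpredD // rpredZ. Qed.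

Section CyclicSubmodule.
Context (R : comNzRingType) (M : lmodType R) (m : M).

Definition mulvec (r : R^o) : M := r *: m.

Lemma mulvec_linear : linear mulvec.
Proof. by move=> a r s; rewrite /mulvec scalerDl scalerA. Qed.
HB.instance Definition _ :=
  GRing.isLinear.Build R R^o M *:%R mulvec mulvec_linear.

Definition cyclic : submodClosed M := im mulvec.

Lemma mem_cyclic x : reflect (exists r : R, x = r *: m) (x \in cyclic).
Proof. exact: (mem_im mulvec x). Qed.

Lemma cyclic_gen : m \in cyclic.
Proof. by apply/mem_cyclic; exists 1; rewrite scale1r. Qed.

Lemma cyclic_cyclic : cyclic_submod cyclic.
Proof. by exists m => x; split=> /mem_cyclic. Qed.

End CyclicSubmodule.

Section Adjoin.
Context (R : pzRingType) (M : lmodType R) (K : submodClosed M) (m : M).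

Definition adjoin_pred : {pred M} := fun x =>
  `[< exists k r, k \in K /\ x = k + r *: m >].

Lemma adjoin_closed : subsemimod_closed adjoin_pred.
Proof.
split; first split.
- by apply/asboolP; exists 0, 0; rewrite rpred0 scale0r addr0.
- move=> _ _ /asboolP[k [r [Kk ->]]] /asboolP[k' [r' [Kk' ->]]].
  apply/asboolP; exists (k + k'), (r + r'); rewrite rpredD //.
  by rewrite scalerDl addrACA.
- move=> a _ /asboolP[k [r [Kk ->]]]; apply/asboolP.
  by exists (a *: k), (a * r); rewrite rpredZ // scalerDr scalerA.
Qed.
HB.instance Definition _ :=
  GRing.isSubSemiModClosed.Build R M adjoin_pred adjoin_closed.

Definition adjoin : submodClosed M := adjoin_pred.

Lemma mem_adjoin x :
  reflect (exists k r, k \in K /\ x = k + r *: m) (x \in adjoin).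
Proof. exact: asboolP. Qed.

Lemma sub_adjoin : {subset K <= adjoin}.
Proof.
by move=> k Kk; apply/mem_adjoin; exists k, 0; rewrite scale0r addr0.
Qed.

Lemma adjoin_gen : m \in adjoin.
Proof. by apply/mem_adjoin; exists 0, 1; rewrite rpred0 scale1r add0r. Qed.

End Adjoin.

Definition adjoin_seq (R : pzRingType) (M : lmodType R) (K : submodClosed M)
  (s : seq M) : submodClosed M := foldr (fun m L => adjoin L m) K s.

Lemma mem_adjoin_seq (R : pzRingType) (M : lmodType R) (K : submodClosed M)
  (s : seq M) : {subset s <= adjoin_seq K s}.
Proof.
elim: s => //= m s IH x; rewrite inE => /orP[/eqP->|/IH]; first exact: adjoin_gen.
exact: sub_adjoin.
Qed.

(** * Pointwise regularity *)

Definition pointwise_regular (R : comNzRingType) (N : lmodType R) : Prop :=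
  forall (a : R) (n : N), exists b : R, a *: n = (a ^+ 2 * b) *: n.

(** What each item gives at once on a cyclic module: a N is contained in
    a^2 N. *)
Definition sqr_absorbing (R : comNzRingType) (N : lmodType R) : Prop :=
  forall (a : R) (n : N), exists n', a *: n = a ^+ 2 *: n'.

Section Regular.
Context (R : comNzRingType) (N : lmodType R) (regN : pointwise_regular N).

Lemma regular_submod (S : submodClosed N) : pointwise_regular (submod S).
Proof.
move=> a n; have [b ab] := regN a (val n); exists b.
by apply: (@submod_val_inj _ _ S); rewrite !linearZ.
Qed.

Lemma regular_coreduced : coreduced N.
Proof.
move=> a [//|k] _ x; apply/mem_im/mem_im => -[n ->] /=; last first.
  by exists (a ^+ k *: n); rewrite /= scalerA exprS.
elim: k n => [|k IH] n; first by exists n; rewrite /= expr1.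
have [b ab] := regN a n; have [n' /= En] := IH (b *: n).
by exists n'; rewrite /= ab [in RHS]exprS -[RHS]scalerA -En !scalerA expr2.
Qed.

Lemma regular_reduced : reduced_module N.
Proof.
move=> a n a2n r; rewrite scalerA mulrC -scalerA; have [b ->] := regN a n.
by rewrite mulrC -scalerA a2n !scaler0.
Qed.

(** If a n = a^2 b n, then n = a b n + (n - a b n) splits n along
    N = a N + l_N(a); the sum is direct because N is reduced. *)
Lemma regular_weakly_endoregular : weakly_endoregular N.
Proof.
have dec a x : exists s t,
    [/\ s \in mul_submod N a, t \in ann_submod N a & x = s + t].
  have [b ab] := regN a x; exists (a *: (b *: x)), (x - a *: (b *: x)).
  split; last by rewrite addrC subrK.
  - by apply/mem_im; exists (b *: x).
  - by apply/mem_ker; rewrite /= scalerBr ab !scalerA expr2 mulrA subrr.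
have cap a x : x \in mul_submod N a -> x \in ann_submod N a -> x = 0.
  move=> /mem_im[y /= ->] /mem_ker /=; rewrite scalerA -expr2 => a2y.
  by have := regular_reduced a2y 1; rewrite scale1r.
move=> a; split; [exists (ann_submod N a) | exists (mul_submod N a)]; split=> //.
- exact: cap.
- by move=> x; have [s [t [*]]] := dec a x; exists t, s; rewrite addrC.
- by move=> x *; exact: (@cap a).
Qed.

End Regular.

Lemma isomorphic_sym (R : pzRingType) (A B : lmodType R) (g : {linear A -> B}) :
  injective g -> (forall v, exists u, g u = v) -> isomorphic B A.
Proof.
move=> g_inj /choice[h hK].
have h_lin : linear h by move=> a u v; apply: g_inj; rewrite linearP !hK.
pose hL : {linear B -> A} := HB.pack h (GRing.isLinear.Build R B A *:%R h h_lin).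
by exists hL; exists g => [|u]; [exact: hK|apply: g_inj; exact: hK].
Qed.

(** The hypotheses say that N is the direct sum of the image and the kernel of
    phi, so the projection of N onto N / phi(N) is bijective on the kernel. *)
Lemma coker_iso_ker (R : comNzRingType) (N : lmodType R) (phi : {linear N -> N}) :
  (forall x, exists z, phi x = phi (phi z)) ->
  (forall x, phi (phi x) = 0 -> phi x = 0) ->
  isomorphic (quotmod (im phi)) (submod (ker phi)).
Proof.
move=> phi_sum phi_cap.
apply: (@isomorphic_sym _ _ _ (quot_pi (im phi) \o submod_incl (ker phi))).
- move=> x y /= /quot_piP/mem_im[z Ez]; apply: submod_val_inj.
  apply/eqP; rewrite -subr_eq0 Ez; apply/eqP/phi_cap.
  have kerP (w : submod (ker phi)) : phi (submod_incl _ w) = 0.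
    by apply/mem_ker; exact: valP.
  by rewrite -Ez linearB !kerP subrr.
- move=> u; have [z Ez] := phi_sum (repr u).
  have kz : repr u - phi z \in ker phi.
    by apply/mem_ker; rewrite linearB Ez subrr.
  exists (Submod kz); rewrite -[RHS]quot_piK; apply/quot_piP/mem_im.
  by exists (- z); rewrite linearN /= addrAC subrr add0r.
Qed.

Section RegularEndomorphisms.
Context (R : comNzRingType) (N : lmodType R) (regN : pointwise_regular N).

Lemma homothety_like_iso (phi : {linear N -> N}) (c : R) :
  (forall x, phi x = c *: x) ->
  isomorphic (quotmod (im phi)) (submod (ker phi)).
Proof.
move=> phiE; apply: coker_iso_ker => x.
  have [b cb] := regN c x; exists (b *: x).
  by rewrite !phiE !scalerA cb expr2.
rewrite !phiE scalerA -expr2 => c2x.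
by have := regular_reduced regN c2x 1; rewrite scale1r.
Qed.

Lemma regular_weakly_morphic : weakly_morphic N.
Proof. by move=> a; exact: (@homothety_like_iso _ a). Qed.

End RegularEndomorphisms.

(** N / a^2 N is isomorphic to the annihilator of a^2, which is killed by a
    since N is reduced. So a kills N / a^2 N. *)
Lemma reduced_weakly_morphic_sqr_absorbing (R : comNzRingType) (N : lmodType R) :
  weakly_morphic N -> reduced_module N -> sqr_absorbing N.
Proof.
move=> wN redN a n; have [f /bij_inj f_inj] := wN (a ^+ 2).
suff /quot_piP/mem_im[n' /= En] :
    quot_pi (mul_submod N (a ^+ 2)) (a *: n) = quot_pi _ 0.
  by exists n'; rewrite -En subr0.
rewrite linearZ linear0; apply: f_inj; rewrite linearZ linear0.
apply: submod_val_inj; rewrite linearZ linear0.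
move: (f _) => k; have /mem_ker /= k0 := valP k.
by have := redN _ _ k0 1; rewrite scale1r.
Qed.

Section CyclicModule.
Context (R : comNzRingType) (M : lmodType R) (S : submodClosed M).
Hypothesis cycS : cyclic_submod S.

Lemma cyclic_genP : exists g : submod S, forall x, exists r : R, x = r *: g.
Proof.
have [n Sn] := cycS.
have Sg : n \in S by apply/Sn; exists 1; rewrite scale1r.
exists (Submod Sg) => x; have [r xE] := (Sn (val x)).1 (valP x).
by exists r; apply: submod_val_inj; rewrite linearZ.
Qed.

Lemma cyclic_endoE (phi : {linear submod S -> submod S}) :
  exists c : R, forall x, phi x = c *: x.
Proof.
have [g gP] := cyclic_genP; have [c gc] := gP (phi g); exists c => x.
by have [r ->] := gP x; rewrite linearZ /= gc !scalerA mulrC.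
Qed.

Hypothesis regS : pointwise_regular (submod S).

Lemma regular_cyclic_morphic : morphic (submod S).
Proof. by move=> phi; have [c /(homothety_like_iso regS)] := cyclic_endoE phi. Qed.

(** If t is the homothety of ratio c and c g = c^2 b g for a generator g, then
    the homothety of ratio b is the required y. *)
Lemma regular_cyclic_abelian_endoregular : abelian_endoregular (submod S).
Proof.
move=> t; have [c tE] := cyclic_endoE t; have [g gP] := cyclic_genP.
have [b cb] := regS c g; exists (homothety _ b) => x /=.
have [r ->] := gP x; rewrite !tE [LHS]scalerA [c * r]mulrC -[LHS]scalerA cb !scalerA.
by congr (_ *: _); ring.
Qed.

End CyclicModule.

(** In the submodule generated by m, the equation a m = a^2 n' has a right-hand
    side of the form a^2 b m. *)
Lemma regular_of_cyclic (R : comNzRingType) (M : lmodType R) :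
  (forall S : submodClosed M, cyclic_submod S -> sqr_absorbing (submod S)) ->
  pointwise_regular M.
Proof.
move=> H a m.
have [n' En] := H _ (cyclic_cyclic m) a (Submod (cyclic_gen m)).
have /mem_cyclic[b n'E] := valP n'; exists b.
by have /(congr1 val) := En; rewrite -scalerA -n'E.
Qed.

(** In n = a s + t with t in the complement T of a N, the element a t is in
    both summands, hence zero. *)
Lemma weakly_endoregular_sqr_absorbing (R : comNzRingType) (N : lmodType R) :
  weakly_endoregular N -> sqr_absorbing N.
Proof.
move=> wN a n; have [[T [dec cap]] _] := wN a.
have [_ [t [/mem_im[s /= ->] Tt nE]]] := dec n; exists s.
rewrite nE scalerDr scalerA -expr2.
suff -> : a *: t = 0 by rewrite addr0.
by apply: cap; [apply/mem_im; exists t | exact: rpredZ].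
Qed.

(** * Purity of the submodules *)

(** The bilinear map f sends (n, r mod a) to r n mod a N; it detects whether
    the tensor n (x) 1 over R / a R vanishes. *)
Section PureScale.
Context (R : comNzRingType) (N : lmodType R) (a : R).

Let E : lmodType R := quotmod (mul_submod R^o a).
Let V : lmodType R := quotmod (mul_submod N a).
Let f (n : N) (e : E) : V := quot_pi _ ((repr e : R) *: n).

Let f_pi n (r : R^o) : f n (quot_pi _ r) = quot_pi _ (r *: n).
Proof.
have /quot_piP/mem_im[s /= Es] := quot_piK (quot_pi (mul_submod R^o a) r).
apply/quot_piP/mem_im; exists (s *: n) => /=.
by rewrite scalerA -scalerBl Es.
Qed.

Let fDl n n' e : f (n + n') e = f n e + f n' e.
Proof. by rewrite /f scalerDr linearD. Qed.
Let fDr n e e' : f n (e + e') = f n e + f n e'.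
Proof.
by rewrite -[e]quot_piK -[e']quot_piK -linearD !f_pi scalerDl linearD.
Qed.
Let fZl c n e : f (c *: n) e = c *: f n e.
Proof. by rewrite /f scalerA mulrC -scalerA linearZ. Qed.
Let fZr c n e : f n (c *: e) = c *: f n e.
Proof. by rewrite -[e]quot_piK -linearZ !f_pi -scalerA linearZ. Qed.

Lemma tens_coker_eq0 (n : N) :
  tens n (quot_pi (mul_submod R^o a) 1 : E) = 0 -> exists n', n = a *: n'.
Proof.
move=> /(congr1 (tensor_lift fDl fDr fZl fZr)).
rewrite tensor_liftE linear0 f_pi scale1r -(linear0 (quot_pi (mul_submod N a))).
by move=> /quot_piP; rewrite subr0 => /mem_im.
Qed.

End PureScale.

(** Purity tested on R / a R: the tensor k (x) 1 becomes n (x) a = 0 in the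
    larger module, so it vanishes already over K. *)
Lemma pure_submod_divisible (R : comNzRingType) (N : lmodType R)
    (K : submodClosed N) (a : R) (k : submod K) (n : N) :
  pure_submod K -> val k = a *: n -> exists k', k = a *: k'.
Proof.
move=> pureK kE; apply: tens_coker_eq0; apply: pureK.
rewrite linear0 tensor_mapE [submod_incl K k]kE tensZl -tensZr.
have -> : a *: quot_pi (mul_submod R^o a) 1 = 0.
  rewrite -linearZ -(linear0 (quot_pi (mul_submod R^o a))).
  by apply/quot_piP/mem_im; exists 1; rewrite subr0.
by rewrite -(scale0r (0 : quotmod (mul_submod R^o a))) tensZr scale0r.
Qed.

Lemma F_regular_regular (R : comNzRingType) (N : lmodType R) :
  F_regular N -> pointwise_regular N.
Proof.
move=> regN a n; pose k := Submod (cyclic_gen (a *: n)).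
have [k' kE] := @pure_submod_divisible _ _ _ a k n (regN _) erefl.
have /mem_cyclic[b k'E] := valP k'; exists b.
have /(congr1 val) /= := kE; rewrite [val _]/= => ->.
by rewrite [LHS](_ : _ = a *: val k') // k'E !scalerA; congr (_ *: _); ring.
Qed.

Section LocalRetraction.
Context (R : comNzRingType) (M : lmodType R) (regM : pointwise_regular M).

(** Modulo the annihilator of m, the finitely generated ideal spanned by ts is
    generated by an idempotent s. Both conclusions are stated on m, so that the
    annihilator does not appear. *)
Lemma regular_idempotent (K : submodClosed M) (m : M) (ts : seq R) :
  {in ts, forall t, t *: m \in K} ->
  exists2 s, s *: m \in K & {in ts, forall t, (t * (1 - s)) *: m = 0}.
Proof.
elim: ts => [|t ts IH] tsK; first by exists 0; rewrite ?scale0r ?rpred0.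
have [|s sK sE] := IH; first by move=> u tu; apply: tsK; rewrite inE tu orbT.
have tK : t *: m \in K by apply: tsK; rewrite mem_head.
(* With e = b t, the witness s' is given by 1 - s' = (1 - s) (1 - e): the   *)
(* factor 1 - s kills the former products, the factor 1 - e kills t m.      *)
have [b tb] := regM t m; exists (s + (1 - s) * b * t).
  by rewrite scalerDl -[X in _ + X]scalerA rpredD // rpredZ.
move=> u; rewrite inE => /orP[/eqP->|/sE us].
- rewrite (_ : t * _ = (1 - s) * (t - t ^+ 2 * b)); last by ring.
  by rewrite -scalerA [(t - _) *: m]scalerBl -tb subrr scaler0.
- rewrite (_ : u * _ = (1 - b * t) * (u * (1 - s))); last by ring.
  by rewrite -scalerA us scaler0.
Qed.

(** The triple (a, x, y) stands for the relation between a x + y, x and y. With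
    a = 1 it expresses additivity, with y = 0 homogeneity. *)
Definition linear_on (N : lmodType R) (rho : M -> N) (t : R * M * M) : Prop :=
  rho (t.1.1 *: t.1.2 + t.2) = t.1.1 *: rho t.1.2 + rho t.2.

(** Choosing for each x a decomposition x = k + c x m with k in K, and c = 0
    on K, makes x |-> k linear up to the defects d t m, which lie in K. By
    regular_idempotent, s m in K can be substituted for m without changing the
    products d t m, and x |-> k + c x s m is linear on the given triples. *)
Lemma local_retraction_adjoin (K : submodClosed M) (m : M) (ts : seq (R * M * M)) :
  exists rho : M -> M,
   [/\ {in K, forall k, rho k = k},
       {in adjoin K m, forall x, rho x \in K} &
       {in ts, forall t, t.1.2 \in adjoin K m -> t.2 \in adjoin K m ->
               linear_on rho t}].
Proof.
have /choice[c cP] (x : M) : exists c : R,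
    (x \in K -> c = 0) /\ (x \in adjoin K m -> x - c *: m \in K).
  have [Kx|nKx] := boolP (x \in K).
    by exists 0; rewrite scale0r subr0.
  have [/mem_adjoin[k [r [Kk ->]]]|] := boolP (x \in adjoin K m); last by exists 0.
  by exists r; rewrite addrK.
have comb a (x y : M) p q :
    a *: (x - p *: m) + (y - q *: m) = a *: x + y - (a * p + q) *: m.
  by rewrite scalerBr scalerA addrACA -opprD scalerDl.
pose d (t : R * M * M) := c (t.1.1 *: t.1.2 + t.2) - (t.1.1 * c t.1.2 + c t.2).
pose L (t : R * M * M) := (t.1.2 \in adjoin K m) && (t.2 \in adjoin K m).
have [_ /mapP[t + ->]|s sK sE] :=
    @regular_idempotent K m [seq d t | t <- ts & L t].
  rewrite mem_filter => /andP[/andP[Lx Ly] _].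
  have Lxy : t.1.1 *: t.1.2 + t.2 \in adjoin K m by rewrite rpredD ?rpredZ.
  have -> : d t *: m = t.1.1 *: (t.1.2 - c t.1.2 *: m) + (t.2 - c t.2 *: m)
      - (t.1.1 *: t.1.2 + t.2 - c (t.1.1 *: t.1.2 + t.2) *: m).
    by rewrite comb opprB addrC addrA subrK scalerBl.
  apply: submodB; last exact: (cP _).2.
  by apply: rpredD; [apply: rpredZ|]; exact: (cP _).2.
exists (fun x => x - (c x * (1 - s)) *: m); split.
- by move=> x Kx /=; rewrite (cP x).1 // mul0r scale0r subr0.
- move=> x Lx /=; rewrite mulrBr mulr1 scalerBl opprB addrA addrAC.
  by rewrite rpredD ?(cP x).2 // -scalerA rpredZ.
- move=> t tts Lx Ly; rewrite /linear_on comb.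
  have /sE : d t \in [seq d t | t <- ts & L t].
    by rewrite map_f // mem_filter /L Lx Ly.
  move=> /eqP; rewrite /d mulrBl scalerBl subr_eq0 => /eqP ->.
  by rewrite mulrDl mulrA.
Qed.

(** The generators are removed one by one. The map that removes m carries the
    triples ts to triples lying over the remaining generators, and those are the
    ones that the next map has to respect. *)
Lemma local_retraction (K : submodClosed M) (s : seq M) (ts : seq (R * M * M)) :
  {in ts, forall t, t.1.2 \in adjoin_seq K s /\ t.2 \in adjoin_seq K s} ->
  exists rho : M -> M,
   [/\ {in K, forall k, rho k = k},
       {in adjoin_seq K s, forall x, rho x \in K} &
       {in ts, forall t, linear_on rho t}].
Proof.
elim: s ts => [|m s IH] ts tsL; first by exists id; split=> // t tts.
have [rho1 [id1 K1 lin1]] := local_retraction_adjoin (adjoin_seq K s) m ts.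
have [|rho [idK rhoK lin]] :=
    IH [seq (t.1.1, rho1 t.1.2, rho1 t.2) | t <- ts].
  by move=> _ /mapP[t /tsL[Lx Ly] ->] /=; rewrite !K1.
exists (rho \o rho1); split.
- move=> k Kk /=; rewrite id1 ?idK //.
  by elim: (s) => //= ? ? ?; exact: sub_adjoin.
- by move=> x Lx /=; exact/rhoK/K1.
- move=> t tts; have [Lx Ly] := tsL _ tts.
  rewrite /linear_on /= lin1 //; exact: (lin _ (map_f _ tts)).
Qed.

End LocalRetraction.

Section TensorVanishing.
Context (R : comNzRingType) (M E : lmodType R) (K : submodClosed M).

(** The map induced by rho on formal sums of pairs. It need not factor
    through the tensor product of M and E, as rho need not be linear. *)
Definition tens_along (rho : M -> submod K) (x : M * E) : tensor (submod K) E :=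
  tens (rho x.1) x.2.

(** The formal sums which vanish in the tensor product of K and E along any
    retraction respecting suitable finitely many linear relations. They form
    a submodule that contains the relations defining the tensor product, hence
    also everything that vanishes in the tensor product of M and E. *)
Definition killed_pred : {pred {freeg (M * E) / R}} := fun D =>
  `[< exists ts : seq (R * M * M), forall rho : M -> submod K,
      (forall k, rho (val k) = k) -> {in ts, forall t, linear_on rho t} ->
      free_lift (tens_along rho) D = 0 >].

Lemma killed_closed : subsemimod_closed killed_pred.
Proof.
split; first split.
- by apply/asboolP; exists [::] => rho _ _; rewrite linear0.
- move=> D D' /asboolP[ts tsD] /asboolP[ts' tsD']; apply/asboolP.
  exists (ts ++ ts') => rho rhoK lin; rewrite linearD /=.
  rewrite tsD ?tsD' ?addr0 // => t tt; apply: lin; rewrite mem_cat tt //.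
  by rewrite orbT.
- move=> a D /asboolP[ts tsD]; apply/asboolP; exists ts => rho rhoK lin.
  by rewrite linearZ /= tsD ?scaler0.
Qed.
HB.instance Definition _ :=
  GRing.isSubSemiModClosed.Build R {freeg (M * E) / R} killed_pred killed_closed.

Lemma rel_killed (D : {freeg (M * E) / R}) :
  D \in Defs.span (@tensor_rel R M E) ->
  exists ts : seq (R * M * M), forall rho : M -> submod K,
    (forall k, rho (val k) = k) -> {in ts, forall t, linear_on rho t} ->
    free_lift (tens_along rho) D = 0.
Proof.
move=> /asboolP /(_ (killed_pred : submodClosed _)) kD.
apply/asboolP; apply: kD => {}D [n n' e|n e e'|a n e|a n e]; apply/asboolP.
- exists [:: (1, n, n')] => rho rhoK lin.
  have := lin _ (mem_head _ _); rewrite /linear_on /= !scale1r => nE.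
  rewrite !linearB /= !free_liftU /tens_along /= nE tensDl.
  by rewrite addrAC addrK subrr.
- exists [::] => rho _ _.
  rewrite !linearB /= !free_liftU /tens_along /= tensDr.
  by rewrite addrAC addrK subrr.
- exists [:: (a, n, 0)] => rho rhoK lin.
  have := lin _ (mem_head _ _); rewrite /linear_on /= addr0.
  have -> : rho 0 = 0 by have := rhoK 0; rewrite linear0.
  rewrite addr0 => nE.
  by rewrite linearB linearZ /= !free_liftU /tens_along /= nE tensZl subrr.
- exists [::] => rho _ _.
  by rewrite linearB linearZ /= !free_liftU /tens_along /= tensZr subrr.
Qed.

(** An element of the tensor product of K and E is recovered, along any
    retraction, from a single formal sum representing its image. *)
Lemma tensor_map_lift (u : tensor (submod K) E) :
  exists2 D : {freeg (M * E) / R},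
    quot_pi _ D = tensor_map (submod_incl K) E u &
    forall rho : M -> submod K, (forall k, rho (val k) = k) ->
      free_lift (tens_along rho) D = u.
Proof.
elim/tensor_ind: u => [|n e u [D piD rhoD]].
  by exists 0 => [|rho _]; rewrite !linear0.
exists (<< (val n, e) >> + D) => [|rho rhoK].
  by rewrite linearD [RHS]linearD tensor_mapE -piD.
by rewrite linearD /= rhoD // free_liftU /tens_along /= rhoK.
Qed.

Lemma pure_of_local_retractions :
  (forall ts : seq (R * M * M), exists rho : M -> submod K,
     (forall k, rho (val k) = k) /\ {in ts, forall t, linear_on rho t}) ->
  injective (tensor_map (submod_incl K) E).
Proof.
move=> retr; apply: raddf_inj => u u0.
have [D piD rhoD] := tensor_map_lift u.
have /rel_killed[ts tsD] : D \in Defs.span (@tensor_rel R M E).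
  rewrite -[D]subr0; apply/quot_piP; rewrite linear0; exact: etrans piD u0.
by have [rho [rhoK lin]] := retr ts; rewrite -(rhoD rho) // tsD.
Qed.

End TensorVanishing.

Lemma regular_F_regular (R : comNzRingType) (N : lmodType R) :
  pointwise_regular N -> F_regular N.
Proof.
move=> regN K E; apply: pure_of_local_retractions => ts.
pose s := [seq t.1.2 | t <- ts] ++ [seq t.2 | t <- ts].
have tsL : {in ts, forall t,
    t.1.2 \in adjoin_seq K s /\ t.2 \in adjoin_seq K s}.
  move=> t tts; split; apply: mem_adjoin_seq; rewrite mem_cat.
    by rewrite (map_f (fun t => t.1.2)).
  by rewrite orbC (map_f (fun t => t.2)).
have [rho [idK rhoK lin]] := local_retraction regN tsL.
(* The values of rho outside K are replaced by 0; this only concerns elements *)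
(* outside the submodule generated by K and s.                                *)
have valE x : x \in adjoin_seq K s ->
    val (insubd (0 : submod K) (rho x)) = rho x.
  by move=> /rhoK; exact: insubdK.
exists (fun x => insubd 0 (rho x)); split=> [k|t tts].
  by rewrite idK ?valKd //; exact: valP.
have [Lx Ly] := tsL t tts; apply: submod_val_inj.
rewrite linearD linearZ /= !valE //; first exact: lin.
by rewrite rpredD ?rpredZ.
Qed.

Theorem theorem4 (R : comNzRingType) (M : lmodType R)
  (M_neq0 : exists x : M, x != 0) :
  [<-> (* 1 *) F_regular M;
       (* 2 *) forall S : submodClosed M, weakly_endoregular (submod S);
       (* 3 *) forall S : submodClosed M,
                 weakly_morphic (submod S) /\ reduced_module (submod S);
       (* 4 *) forall S : submodClosed M, cyclic_submod S ->
                 weakly_morphic (submod S) /\ reduced_module (submod S);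
       (* 4' *) forall S : submodClosed M, cyclic_submod S ->
                 morphic (submod S) /\ reduced_module (submod S);
       (* 5 *) forall S : submodClosed M, cyclic_submod S ->
                 coreduced (submod S);
       (* 6 *) forall S : submodClosed M, cyclic_submod S ->
                 abelian_endoregular (submod S);
       (* 7 *) forall S : submodClosed M, cyclic_submod S ->
                 F_regular (submod S)].
Proof.
(* Each implication passes through the pointwise regularity of M. *)
tfae.
- move=> /F_regular_regular regM S.
  exact/regular_weakly_endoregular/regular_submod.
- move=> H.
  have regM : pointwise_regular M.
    apply: regular_of_cyclic => S _.
    exact: weakly_endoregular_sqr_absorbing (H S).
  move=> S; split; last exact/regular_reduced/regular_submod.
  exact/regular_weakly_morphic/regular_submod.
- by move=> H S _.
- move=> H.
  have regM : pointwise_regular M.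
    apply: regular_of_cyclic => S /H[].
    exact: reduced_weakly_morphic_sqr_absorbing.
  move=> S cycS; split; last exact/regular_reduced/regular_submod.
  exact/regular_cyclic_morphic/regular_submod.
- move=> H.
  have regM : pointwise_regular M.
    apply: regular_of_cyclic => S /H[mS].
    by apply: reduced_weakly_morphic_sqr_absorbing => a; exact: mS.
  by move=> S _; exact/regular_coreduced/regular_submod.
- move=> H.
  have regM : pointwise_regular M.
    apply: regular_of_cyclic => S /H cS a n.
    have /mem_im[n' /= ->] : a *: n \in mul_submod (submod S) (a ^+ 2).
      by rewrite -cS //; apply/mem_im; exists n.
    by exists n'.
  move=> S cycS; exact/regular_cyclic_abelian_endoregular/regular_submod.
- move=> H.
  have regM : pointwise_regular M.
    apply: regular_of_cyclic => S /H eS a n.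
    have [y yE] := eS (homothety _ a); exists (y n).
    by have /= -> := yE n; rewrite scalerA expr2.
  by move=> S _; exact/regular_F_regular/regular_submod.
- move=> H; apply: regular_F_regular; apply: regular_of_cyclic => S cycS a n.
  have [b ab] := F_regular_regular (H S cycS) a n.
  by exists (b *: n); rewrite scalerA.
Qed.
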